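(* $$2\pi^2\int_{\mathcal D} t\;dt\,dy_1\,dy_2=\frac{2\pi^2}{3}\,C,$$ where $\mathcal D=\{(t,y_1,y_2)\in\mathbb R^3:\ t>0,\ t^2\le y_1^2+y_2^2+1/t^2,\ 2|y_1|\le t,\ 2|y_2|\le t\}$ and $C=\sum_{n=1}^\infty\frac{(-1)^{n-1}}{(2n-1)^2}$ is Catalan's constant.
   Context: The left-hand side, denoted $\mathrm{vol}\,\widehat\Gamma$ in the paper, is the volume of the set of $\mathbb Z[i]$-reduced bases: writing $V\in\mathrm{SL}_2(\mathbb C)$ as $V=UT$ with $U\in\mathrm{SU}(2)$ and $T$ upper triangular with diagonal entries $t>0$, $1/t$ and off-diagonal entry $y_1+iy_2$, the invariant measure on $\mathrm{SL}_2(\mathbb C)$, after integrating out $U$ and restricting to shortest reduced bases over the Gaussian integers, is $2\pi^2\,t\,dt\,dy_1\,dy_2$ on $\mathcal D$. *)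

(* Defs.v *)
(* Based on MathComp-Analysis: the reals are an arbitrary [R : realType]. *)
From HB Require Import structures.
From mathcomp Require Import all_boot all_order all_algebra.
From mathcomp Require Import all_classical all_reals all_analysis.

Set Implicit Arguments.
Unset Strict Implicit.
Unset Printing Implicit Defensive.

Import Order.TTheory GRing.Theory Num.Theory.
Import numFieldNormedType.Exports.

Local Open Scope classical_set_scope.
Local Open Scope ring_scope.

Definition reduced_domain (R : realType) : set (R * R * R) :=
  [set p | let: (t, y1, y2) := p in
    [/\ 0 < t,
        t ^+ 2 <= y1 ^+ 2 + y2 ^+ 2 + 1 / t ^+ 2,
        2 * `|y1| <= t &
        2 * `|y2| <= t]].

(* Since n >= 1, the truncated subtractions n - 1 and 2n - 1 are exact. *)
Definition catalan (R : realType) : R :=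
  limn (fun N : nat =>
    \sum_(1 <= n < N.+1) (-1) ^+ (n - 1) / (2 * n - 1)%N%:R ^+ 2 : R).

(* Main.v *)
Require Import Defs.
From HB Require Import structures.
From mathcomp Require Import all_boot all_order all_algebra.
From mathcomp Require Import all_classical all_reals all_analysis.
From mathcomp Require Import measurable_realfun.
From mathcomp Require Import ring lra.
Import Order.TTheory GRing.Theory Num.Theory.
Import numFieldNormedType.Exports.
Local Open Scope classical_set_scope.
Local Open Scope ring_scope.

(** Let I be the integral of t over the domain D; it has to be shown that
    I = C / 3, with C Catalan's constant.

    At a fixed height t > 0, substitute y = t (u, v). The constraints become
    |u|, |v| <= 1/2 and t^4 (1 - u^2 - v^2) <= 1, and the integrand becomes t^3
    ([integral_domain_slice]). Exchanging the integrals, the integral over t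
    has an elementary value ([integral_scaled_integrand]), so that I is the
    integral of 1 / (4 (1 - u^2 - v^2)) over the square |u|, |v| <= 1/2.

    The diagonals cut this square into the two double triangles |v| <= |u| and
    |u| < |v|, which contribute equally. On the first one the integral over v
    is again elementary ([integral_symmetric_slice]), and by parity
      I = integral over u in [0, 1/2] of ln ((s + u) / (s - u)) / s,
    where s = sqrt (1 - u^2). With u = sin a, this is the integral of
    ln (tan (pi/4 + a)) over a in [0, pi/6]. So I = K (pi/4) - K (5 pi/12),
    where K is the antiderivative of - ln tan on ]0, pi/2[ that tends to 0 at 0.

    It remains to compute this difference ([logtan_int_gap]). In terms of the
    inverse tangent integral Ti2 (x) = integral over [0, x] of atan s / s,
    K (t) = Ti2 (tan t) - t ln (tan t). Two facts about K are used:
    - K (pi/4) = Ti2 (1) = C, by the Taylor expansion of atan with remainder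
      ([ti2_1]);
    - integrating the logarithm of
        tan (3 t) = tan t tan (pi/3 - t) tan (pi/3 + t)
      gives K (3 t) / 3 = K (t) + K (pi/3 + t) - K (pi/3 - t).
    At t = pi/12 the second one reads C / 3 = K (pi/12) + K (5 pi/12) - C, and
    K (pi/12) = K (5 pi/12) by the symmetry K (pi/2 - t) = K (t)
    ([logtan_int_sym]). Hence K (5 pi/12) = 2 C / 3 and I = C / 3. *)

(** * Derivatives and antiderivatives *)

Lemma eq_is_derive {R : realType} {f g : R -> R} {x a b : R} :
  is_derive x 1 f a -> f =1 g -> a = b -> is_derive x 1 g b.
Proof. by move=> df /funext <- <-. Qed.

Lemma is_derive_monomial (R : realType) (c x : R) (k : nat) :
  is_derive x 1 (fun y : R => c * y ^+ k.+1) (c * (k.+1%:R * x ^+ k)).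
Proof.
apply: (eq_is_derive (is_deriveZ c (is_deriveX k.+1 (is_derive_id x 1)))) => [y|].
  by rewrite exprfctE.
by rewrite /GRing.scale/= mulr1.
Qed.

Lemma is_derive_compBl {R : realType} {f : R -> R} {a t df : R} :
  is_derive (a - t) 1 f df -> is_derive t 1 (fun s => f (a - s)) (- df).
Proof.
move=> d; have d' : is_derive t 1 (fun s : R => a - s) (0 - 1).
  exact: is_deriveB (is_derive_cst a t 1) (is_derive_id t 1).
apply: (eq_is_derive
  (@is_derive1_comp R f (fun s : R => a - s) t df _ d d')) => [//|].
by rewrite sub0r mulrN1.
Qed.

Lemma is_derive_compDl {R : realType} {f : R -> R} {a t df : R} :
  is_derive (a + t) 1 f df -> is_derive t 1 (fun s => f (a + s)) df.
Proof.
move=> d; have d' : is_derive t 1 (fun s : R => a + s) (0 + 1).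
  exact: is_deriveD (is_derive_cst a t 1) (is_derive_id t 1).
apply: (eq_is_derive (is_derive1_comp d d')) => [//|].
by rewrite add0r mulr1.
Qed.

Lemma is_derive_compMl {R : realType} {f : R -> R} {a t df : R} :
  is_derive (a * t) 1 f df -> is_derive t 1 (fun s => f (a * s)) (a * df).
Proof.
move=> d; have d' : is_derive t 1 (fun s : R => a * s) (a * 1).
  apply: (eq_is_derive (is_deriveZ a (is_derive_id t 1))) => [//|//].
apply: (eq_is_derive (is_derive1_comp d d')) => [//|].
by rewrite mulr1 mulrC.
Qed.

Lemma derive0_eq (R : realType) (f : R -> R) (a b : R) : a <= b ->
  (forall x, a < x < b -> is_derive x 1 f 0) -> {within `[a, b], continuous f} ->
  f b = f a.
Proof.
move=> ab df cf.
have dfo (x : R) : x \in `]a, b[ -> is_derive x 1 f ((fun=> 0) x).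
  by rewrite in_itv; exact: df.
have [c _] := MVT_segment ab dfo cf.
by rewrite mul0r => /eqP; rewrite subr_eq0 => /eqP.
Qed.

Lemma integral_antiderivative {R : realType} {f F : R -> R} {a b : R} : a < b ->
  (forall x, a <= x <= b -> is_derive x 1 F (f x)) ->
  (forall x, a <= x <= b -> {for x, continuous f}) ->
  (\int[lebesgue_measure]_(x in `[a, b]) (f x)%:E = (F b - F a)%:E)%E.
Proof.
move=> ab dF cf.
have drv (x : R) : a <= x <= b -> derivable F x 1.
  by move=> xab; exact: (@ex_derive _ _ _ _ _ _ _ (dF x xab)).
have cF (x : R) : a <= x <= b -> {for x, continuous F}.
  by move=> xab; apply/differentiable_continuous/derivable1_diffP; exact: drv.
rewrite (@continuous_FTC2 R f F)//.
- apply: continuous_in_subspaceT => x /[!inE]; rewrite /= in_itv/=.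
  exact: cf.
- split.
  + by move=> x; rewrite in_itv/= => /andP[ax xb]; apply: drv; rewrite !ltW.
  + by apply: cvg_at_right_filter; apply: cF; rewrite lexx ltW.
  + by apply: cvg_at_left_filter; apply: cF; rewrite lexx ltW.
- move=> x; rewrite in_itv/= => /andP[ax xb].
  have xab : a <= x <= b by rewrite !ltW.
  by rewrite derive1E (@derive_val _ _ _ _ _ _ _ (dF x xab)).
Qed.

(** * The inverse tangent integral and Catalan's constant *)

(** The value at 0 makes this function continuous, so that its antiderivative is
    differentiable on both sides of 0. *)
Definition atan_quot {R : realType} (x : R) : R :=
  if x == 0 then 1 else atan x / x.

Lemma continuous_atan_quot (R : realType) : continuous (@atan_quot R).
Proof.
move=> x; have [->|x0] := eqVneq x 0.
  apply/continuous_withinNx; rewrite {2}/atan_quot eqxx.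
  have [d dv] := is_derive1_atan (0 : R).
  rewrite expr0n/= addr0 invr1 in dv; rewrite -dv.
  (* Near 0 the quotient is the difference quotient of atan at 0. *)
  move: d; rewrite /derivable /derive => d; apply: cvg_trans d.
  apply: near_eq_cvg; near=> h0.
  rewrite /= addr0 atan0 subr0 /atan_quot.
  have -> : h0 == 0 = false by apply/negbTE; near: h0; exact: nbhs_dnbhs_neq.
  by rewrite -[h0 *: 1]/(h0 * 1) mulr1 mulrC.
have : {for x, continuous (fun y : R => atan y / y)}.
  apply: continuousM; first exact: continuous_atan.
  exact: continuousV.
rewrite /prop_for /continuous_at {2}/atan_quot (negbTE x0).
apply: cvg_trans; apply: near_eq_cvg; near=> y; rewrite /atan_quot.
have -> // : y == 0 = false; apply/negbTE; near: y.
exact: (open_neq x0).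
Unshelve. all: by end_near. Qed.

(** The inverse tangent integral. The base point -1 puts 0 in the interior of the
    interval of integration; any negative number would do. *)
Definition ti2 {R : realType} (x : R) : R :=
  \int[lebesgue_measure]_(s in `[-1, x]) atan_quot s -
  \int[lebesgue_measure]_(s in `[-1, 0]) atan_quot s.

Lemma ti2_0 (R : realType) : ti2 0 = 0 :> R.
Proof. exact: subrr. Qed.

Lemma is_derive_ti2 {R : realType} {x : R} : -1 < x ->
  is_derive x 1 ti2 (atan_quot x).
Proof.
move=> x1.
pose G y := \int[lebesgue_measure]_(s in `[-1, y]) (@atan_quot R s).
have [dG G'] : derivable G x 1 /\ derive1 G x = atan_quot x.
  apply: (@continuous_FTC1_closed _ atan_quot (-1) x (x + 1)) => //; first lra.
    apply: continuous_compact_integrable; first exact: segment_compact.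
    exact/continuous_subspaceT/continuous_atan_quot.
  exact: continuous_atan_quot.
have dG' : is_derive x 1 G (atan_quot x).
  by apply: (DeriveDef dG); rewrite -derive1E.
by rewrite -[atan_quot x]subr0; exact: is_deriveB.
Qed.

Definition arctan_partial {R : realType} (N : nat) (x : R) : R :=
  \sum_(i < N) (-1) ^+ i / i.*2.+1%:R * x ^+ i.*2.+1.

Definition ti2_partial {R : realType} (N : nat) (x : R) : R :=
  \sum_(i < N) (-1) ^+ i / i.*2.+1%:R ^+ 2 * x ^+ i.*2.+1.

(** The derivative of the partial sum is the geometric sum of ratio - x^2. *)
Lemma is_derive_arctan_remainder (R : realType) (N : nat) (x : R) :
  is_derive x 1 (fun y => atan y - arctan_partial N y)
    ((- x ^+ 2) ^+ N / (1 + x ^+ 2)).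
Proof.
have x2 : 1 + x ^+ 2 != 0 by rewrite gt_eqF// ltr_wpDr// sqr_ge0.
elim: N => [|N IH].
  rewrite expr0 mul1r; apply: (eq_is_derive (is_derive1_atan x)) => // y.
  by rewrite /arctan_partial big_ord0 subr0.
apply: (eq_is_derive (is_deriveB IH
  (is_derive_monomial _ ((-1) ^+ N / N.*2.+1%:R) x N.*2))) => [y|].
  by rewrite /arctan_partial big_ord_recr/= opprD addrA.
have n0 : N.*2.+1%:R != 0 :> R by rewrite pnatr_eq0.
rewrite [in RHS]exprS -mul2n exprM mul2n -[- x ^+ 2]mulN1r exprMn.
by move: (N.*2.+1%:R) n0 => m n0; field; rewrite n0 x2.
Qed.

(** The derivative of the remainder is at most x^(2N) in absolute value, which is
    the derivative of the right-hand side; both sides vanish at 0. *)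
Lemma arctan_remainder_le {R : realType} (N : nat) {x : R} : 0 <= x ->
  `|atan x - arctan_partial N x| <= x ^+ N.*2.+1 / N.*2.+1%:R.
Proof.
move=> x0.
have part0 : arctan_partial N 0 = 0 :> R.
  by rewrite /arctan_partial big1// => i _; rewrite expr0n/= mulr0.
(* The sign s = 1 gives the upper bound, and s = -1 the lower one. *)
have key (s : R) : `|s| = 1 ->
    s * (atan x - arctan_partial N x) <= x ^+ N.*2.+1 / N.*2.+1%:R.
  move=> s1.
  pose h y : R :=
    (N.*2.+1%:R)^-1 * y ^+ N.*2.+1 - s * (atan y - arctan_partial N y).
  have dh (y : R) :
      is_derive y 1 h (y ^+ N.*2 - s * ((- y ^+ 2) ^+ N / (1 + y ^+ 2))).
    have dz := is_deriveZ s (is_derive_arctan_remainder R N y).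
    have dm := is_derive_monomial R (N.*2.+1%:R)^-1 y N.*2.
    apply: (eq_is_derive (is_deriveB dm dz)) => [//|].
    rewrite mulrA mulVf ?mul1r ?pnatr_eq0//.
  have h' (y : R) : 0 <= derive1 h y.
    rewrite derive1E (@derive_val _ _ _ _ _ _ _ (dh y)) subr_ge0.
    apply: le_trans (ler_norm _) _; rewrite normrM s1 mul1r normrM normrX normrN.
    rewrite (ger0_norm (sqr_ge0 y)) -exprM mul2n.
    have y2 : 1 <= 1 + y ^+ 2 by rewrite lerDl sqr_ge0.
    have y2p : 0 < 1 + y ^+ 2 by rewrite (lt_le_trans _ y2).
    rewrite ler_piMr// ?exprn_even_ge0 ?odd_double//.
    by rewrite ger0_norm ?invr_ge0 ?(ltW y2p)// invf_le1.
  have : h 0 <= h x.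
    apply: (@ger0_derive1_ndecr _ h 0 x) => //.
    apply: derivable_within_continuous => y _.
    exact: (@ex_derive _ _ _ _ _ _ _ (dh y)).
  rewrite /h atan0 part0 subr0 mulr0 expr0n/= mulr0 subr0 subr_ge0 mulrC.
  by move=> /le_trans; apply; rewrite mulrC.
rewrite ler_norml; apply/andP; split.
  by have := key (-1) (normrN1 _); rewrite mulN1r lerNl.
by have := key 1 (normr1 _); rewrite mul1r.
Qed.

Lemma is_derive_ti2_remainder (R : realType) (F : R -> R) (N : nat) (x : R) :
  x != 0 -> is_derive x 1 F (atan_quot x) ->
  is_derive x 1 (fun y => F y - ti2_partial N y)
    ((atan x - arctan_partial N x) / x).
Proof.
move=> x0 dF; elim: N => [|N IH].
  rewrite /atan_quot (negbTE x0) in dF.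
  rewrite /arctan_partial big_ord0 subr0.
  apply: (eq_is_derive dF) => // y.
  by rewrite /ti2_partial big_ord0 subr0.
apply: (eq_is_derive (is_deriveB IH
  (is_derive_monomial _ ((-1) ^+ N / N.*2.+1%:R ^+ 2) x N.*2))) => [y|].
  by rewrite /ti2_partial big_ord_recr/= opprD addrA.
have n0 : N.*2.+1%:R != 0 :> R by rewrite pnatr_eq0.
rewrite [in RHS]/arctan_partial big_ord_recr/= -/(arctan_partial N x) [in RHS]exprS.
by move: (N.*2.+1%:R) n0 => m n0; field; rewrite n0 x0.
Qed.

Lemma derivable_ti2_partial (R : realType) (N : nat) (x : R) :
  derivable (@ti2_partial R N) x 1.
Proof.
elim: N => [|N IH].
  rewrite (_ : ti2_partial 0 = cst 0); first exact: derivable_cst.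
  by apply/funext => y; rewrite /ti2_partial big_ord0.
rewrite (_ : ti2_partial N.+1 = ti2_partial N + fun y : R =>
  (-1) ^+ N / N.*2.+1%:R ^+ 2 * y ^+ N.*2.+1); last first.
  by apply/funext => y; rewrite /ti2_partial big_ord_recr.
apply: derivableD; first exact: IH.
exact: (@ex_derive _ _ _ _ _ _ _ (is_derive_monomial _ _ _ _)).
Qed.

(** By the mean value theorem the N-th remainder of Ti2 at 1 is the derivative of
    the remainder at some c in ]0, 1[, that is the N-th remainder of atan at c
    divided by c; this is at most c^(2N) / (2N + 1). *)
Lemma ti2_1 (R : realType) : @ti2 R 1 = catalan R.
Proof.
have bound (N : nat) : `|@ti2 R 1 - ti2_partial N 1| <= (N.+1%:R)^-1.
  have p0 : ti2_partial N 0 = 0 :> R.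
    by rewrite /ti2_partial big1// => i _; rewrite expr0n/= mulr0.
  have dr (x : R) : 0 <= x <= 1 ->
      derivable (fun y : R => @ti2 R y - ti2_partial N y) x 1.
    move=> /andP[x0 x1]; have x_gtN1 : -1 < x by lra.
    apply: derivableB; last exact: derivable_ti2_partial.
    exact: (@ex_derive _ _ _ _ _ _ _ (is_derive_ti2 x_gtN1)).
  have [] := @MVT R (fun y : R => @ti2 R y - ti2_partial N y)
    (fun x => (atan x - arctan_partial N x) / x) 0 1 ltr01.
  - move=> x /[!in_itv]/= /andP[x0 x1]; apply: is_derive_ti2_remainder.
      by rewrite gt_eqF.
    by apply: is_derive_ti2; lra.
  - apply: derivable_within_continuous => x /[!in_itv]/=; exact: dr.
  move=> c /[!in_itv]/= /andP[c0 c1].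
  rewrite ti2_0 p0 !subr0 mulr1 => ->.
  rewrite normrM normrV ?unitfE ?gt_eqF// (gtr0_norm c0) ler_pdivrMr//.
  apply: le_trans (arctan_remainder_le _ (ltW c0)) _.
  rewrite exprS -mulrA mulrC ler_pM2r//.
  apply: le_trans (_ : (N.*2.+1%:R)^-1 <= _).
    rewrite ler_piMl ?invr_ge0 ?ler0n// exprn_ile1// ltW//.
  by rewrite lef_pV2 ?posrE ?ltr0n// ler_nat ltnS -addnn leq_addr.
apply/esym/cvg_lim => //.
rewrite (_ : (fun _ => _) = (fun N => ti2_partial N 1)); last first.
  apply/funext => N; rewrite /ti2_partial big_add1/= big_mkord.
  apply: eq_bigr => i _; rewrite expr1n mulr1 subn1/=.
  by rewrite (_ : (2 * i.+1 - 1)%N = i.*2.+1)// mulnS mul2n.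
apply/cvgrPdist_le => e e0.
near=> N; apply: le_trans (bound N) _.
by near: N; apply: filterS (near_infty_natSinv_lt (PosNum e0)) => n /ltW.
Unshelve. all: by end_near. Qed.

(** * The integral of - ln tan *)

(** This closed form is the integral of - ln tan over [0, t], for t in ]0, pi/2[. *)
Definition logtan_int {R : realType} (t : R) : R := ti2 (tan t) - t * ln (tan t).

Lemma tan_gt0_pihalf {R : realType} {t : R} : 0 < t < pi / 2 -> 0 < tan t.
Proof.
move=> /andP[t0 tpi]; rewrite /tan divr_gt0//.
  by apply: sin_gt0_pihalf; rewrite t0 tpi.
by apply: cos_gt0_pihalf; rewrite tpi andbT; have := pi_gt0 R; lra.
Qed.

Lemma is_derive_ln_tan {R : realType} {t : R} : 0 < t < pi / 2 ->
  is_derive t 1 (fun s : R => ln (tan s)) ((tan t)^-1 * (cos t)^-2).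
Proof.
move=> tb.
have ct : cos t != 0.
  rewrite gt_eqF// cos_gt0_pihalf//; case/andP: tb => ? ->.
  by have := pi_gt0 R; lra.
exact: (is_derive1_comp (is_derive1_ln (tan_gt0_pihalf tb)) (is_derive_tan ct)).
Qed.

Lemma is_derive_logtan_int {R : realType} {t : R} : 0 < t < pi / 2 ->
  is_derive t 1 logtan_int (- ln (tan t)).
Proof.
move=> tb; have t0 := tan_gt0_pihalf tb.
have ct : cos t != 0.
  rewrite gt_eqF// cos_gt0_pihalf//; case/andP: tb => ? ->.
  by have := pi_gt0 R; lra.
have d1 : is_derive (tan t) 1 ti2 (t / tan t).
  have := @is_derive_ti2 R (tan t); rewrite /atan_quot gt_eqF// tanK; last first.
    by rewrite in_itv/=; case/andP: tb => ? ->; have := pi_gt0 R; lra.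
  by apply; lra.
have d2 := is_derive1_comp d1 (is_derive_tan ct).
have d3 := is_deriveM (is_derive_id t 1) (is_derive_ln_tan tb).
apply: (eq_is_derive (is_deriveB d2 d3)) => [//|].
rewrite /GRing.scale/= mulr1.
by move: (tan t) t0 (cos t) ct (ln _) => T T0 c c0 l; field; rewrite c0 gt_eqF.
Qed.

Lemma tan_pihalfB (R : realType) (t : R) : tan (pi / 2 - t) = (tan t)^-1.
Proof.
have -> : pi / 2 - t = - t + pi / 2 by ring.
by rewrite /tan sinDpihalf cosDpihalf cosN sinN opprK invf_div.
Qed.

Lemma ln_tan_pihalfB {R : realType} {t : R} : 0 < t < pi / 2 ->
  ln (tan (pi / 2 - t)) = - ln (tan t).
Proof. by move=> tb; rewrite tan_pihalfB lnV// posrE tan_gt0_pihalf. Qed.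

(** Both sides have the same derivative, as tan (pi/2 - t) is the inverse of tan t,
    and they agree at pi/4. *)
Lemma logtan_int_sym (R : realType) (t : R) : 0 < t <= pi / 4 ->
  logtan_int (pi / 2 - t) = logtan_int t.
Proof.
move=> /andP[t0 tpi]; have pi0 := pi_gt0 R.
pose h (s : R) := @logtan_int R (pi / 2 - s) - logtan_int s.
have dh (s : R) : 0 < s < pi / 2 -> is_derive s 1 h 0.
  move=> sb.
  have sb' : 0 < pi / 2 - s < pi / 2 by lra.
  have d1 := is_derive_compBl (is_derive_logtan_int sb').
  apply: (eq_is_derive (is_deriveB d1 (is_derive_logtan_int sb))) => [//|].
  by rewrite (ln_tan_pihalfB sb) opprK; ring.
have : h (pi / 4) = h t.
  apply: (@derive0_eq R h t (pi / 4) tpi).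
    by move=> x xb; apply: dh; lra.
  apply: derivable_within_continuous => x; rewrite in_itv/= => xb.
  have xb' : 0 < x < pi / 2 by lra.
  exact: (@ex_derive _ _ _ _ _ _ _ (dh x xb')).
rewrite /h (_ : pi / 2 - pi / 4 = pi / 4) ?subrr; last by field.
by move/esym/eqP; rewrite subr_eq0 => /eqP.
Qed.

(** With c = cos (pi/3), the equation cos pi = -1 reads (c + 1) (2 c - 1)^2 = 0. *)
Lemma cos_pithird (R : realType) : cos (pi / 3) = 1 / 2 :> R.
Proof.
have pi0 := pi_gt0 R.
have c0 : 0 < cos (pi / 3 : R) by apply: cos_gt0_pihalf; lra.
have : cos (pi / 3 + (pi / 3 + pi / 3)) = -1 :> R.
  by rewrite -[RHS](cospi R); congr cos; field.
rewrite !cosD sinD.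
have := sin2cos2 (pi / 3 : R).
move: (cos _) (sin _) c0 => c s c0 s2 h.
have : (c + 1) * (2 * c - 1) ^+ 2 = 0.
  have e : s * s = 1 - c ^+ 2 by rewrite -s2 expr2.
  rewrite (_ : c * (c * c - s * s) - s * (s * c + c * s) =
    c * (c * c - s * s) - s * s * c - s * s * c) in h; last by ring.
  by rewrite e in h; rewrite -(addNr 1) -[in RHS]h; ring.
by move/eqP; rewrite mulf_eq0 sqrf_eq0 => /orP[] /eqP; lra.
Qed.

(** As sin (pi/3)^2 = 3/4, the product of the last two factors is
    (3 cos^2 - sin^2) / (cos^2 - 3 sin^2) at t. *)
Lemma tan_triple (R : realType) (t : R) : 0 < t < pi / 6 ->
  tan (3 * t) = tan t * (tan (pi / 3 - t) * tan (pi / 3 + t)).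
Proof.
move=> tb; have pi0 := pi_gt0 R.
have c1 : cos (pi / 3 - t) != 0 by rewrite gt_eqF// cos_gt0_pihalf//; lra.
have c2 : cos (pi / 3 + t) != 0 by rewrite gt_eqF// cos_gt0_pihalf//; lra.
have c3 : cos (3 * t) != 0 by rewrite gt_eqF// cos_gt0_pihalf//; lra.
have c4 : cos t != 0 by rewrite gt_eqF// cos_gt0_pihalf//; lra.
have s2 := sin2cos2 (pi / 3 : R).
move: c1 c2 c3; rewrite /tan (_ : 3 * t = t + (t + t)); last by ring.
rewrite !(cosB, sinB, sinD, cosD) !cos_pithird in s2 *.
move: (cos t) (sin t) (sin (pi / 3)) c4 s2 => c s r c4 r2 h1 h2 h3.
rewrite mulf_div mulf_div; apply/eqP; rewrite eqr_div//; last first.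
  by rewrite !mulf_neq0.
apply/eqP.
have E1 : (r * c - 1 / 2 * s) * (r * c + 1 / 2 * s) = (3 * c ^+ 2 - s ^+ 2) / 4.
  by transitivity (r ^+ 2 * c ^+ 2 - s ^+ 2 / 4); [field|rewrite r2; field].
have E2 : (1 / 2 * c + r * s) * (1 / 2 * c - r * s) = (c ^+ 2 - 3 * s ^+ 2) / 4.
  by transitivity (c ^+ 2 / 4 - r ^+ 2 * s ^+ 2); [field|rewrite r2; field].
by rewrite E1 E2; field.
Qed.

Lemma derivable_ti2_tan {R : realType} {t : R} : 0 <= t < pi / 2 ->
  derivable (fun s : R => ti2 (tan s)) t 1.
Proof.
move=> tb; have pi0 := pi_gt0 R.
have ct : cos t != 0 by rewrite gt_eqF// cos_gt0_pihalf//; lra.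
have tt : -1 < tan t.
  apply: lt_le_trans (ltrN10 _) _; case/andP: tb => t0 tpi.
  by rewrite /tan divr_ge0 ?sin_ge0_pi ?cos_ge0_pihalf//; lra.
exact: (@ex_derive _ _ _ _ _ _ _
  (is_derive1_comp (is_derive_ti2 tt) (is_derive_tan ct))).
Qed.

(** Write K for [logtan_int]. The function
      V (t) = K (3 t) / 3 - K (t) - K (pi/3 + t) + K (pi/3 - t)
    has derivative 0 on ]0, pi/6[ by [tan_triple], and it has limit 0 at 0. As
    K (t) contains the product t ln (tan t), this limit is read off W instead:
    there the singular logarithms of K (3 t) / 3 and K (t) are merged into
    ln (tan (3 t) / tan t), which is regular at 0. Then V (pi/12) = 0, and the
    symmetry of K gives the value. *)
Lemma logtan_int_gap (R : realType) :
  3 * (logtan_int (pi / 4) - logtan_int (pi * 5 / 12)) = catalan R.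
Proof.
have pi0 := pi_gt0 R.
pose W (t : R) := ti2 (tan (3 * t)) / 3 - ti2 (tan t)
  - t * (ln (tan (pi / 3 - t)) + ln (tan (pi / 3 + t)))
  - logtan_int (pi / 3 + t) + logtan_int (pi / 3 - t).
pose V (t : R) := logtan_int (3 * t) / 3 - logtan_int t
  - logtan_int (pi / 3 + t) + logtan_int (pi / 3 - t) : R.
have lntan3 (t : R) : 0 < t < pi / 6 -> ln (tan (3 * t)) =
    ln (tan t) + (ln (tan (pi / 3 - t)) + ln (tan (pi / 3 + t))).
  move=> tb; have p1 : 0 < tan t by apply: tan_gt0_pihalf; lra.
  have p2 : 0 < tan (pi / 3 - t) by apply: tan_gt0_pihalf; lra.
  have p3 : 0 < tan (pi / 3 + t) by apply: tan_gt0_pihalf; lra.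
  rewrite tan_triple// lnM ?posrE//; last exact: mulr_gt0.
  by rewrite lnM ?posrE.
have VW (t : R) : 0 < t < pi / 6 -> V t = W t.
  move=> tb; rewrite /V /W {1 2}/logtan_int lntan3//.
  by move: (ln (tan t)) => *; field.
have dV (t : R) : 0 < t < pi / 6 -> is_derive t 1 V 0.
  move=> tb.
  have b3 : 0 < 3 * t < pi / 2 by lra.
  have b1 : 0 < t < pi / 2 by lra.
  have bp : 0 < pi / 3 + t < pi / 2 by lra.
  have bm : 0 < pi / 3 - t < pi / 2 by lra.
  have d3 := is_deriveZ (3^-1) (is_derive_compMl (is_derive_logtan_int b3)).
  have d1 := is_derive_logtan_int b1.
  have dp := is_derive_compDl (is_derive_logtan_int bp).
  have dm := is_derive_compBl (is_derive_logtan_int bm).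
  apply: (eq_is_derive (is_deriveD (is_deriveB (is_deriveB d3 d1) dp) dm)).
    by move=> s; rewrite /V [in RHS](mulrC _ 3^-1).
  rewrite lntan3// /GRing.scale/=; by field.
have dW (t : R) : 0 < t < pi / 12 -> is_derive t 1 W 0.
  move=> tb; apply: near_eq_is_derive (dV t _); last lra.
  have : t \in `]0, pi / 6[ by rewrite in_itv/=; lra.
  by move/near_in_itvoo; apply: filterS => s; rewrite in_itv/=; exact: VW.
have cW : {within `[0, pi / 12], continuous W}.
  apply: derivable_within_continuous => t; rewrite in_itv/= => tb.
  have b3 : 0 <= 3 * t < pi / 2 by lra.
  have b1 : 0 <= t < pi / 2 by lra.
  have bp : 0 < pi / 3 + t < pi / 2 by lra.
  have bm : 0 < pi / 3 - t < pi / 2 by lra.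
  have d3 := is_derive_compMl (f := fun s => ti2 (tan s))
    (derivableP (derivable_ti2_tan b3)).
  have d1 := derivableP (derivable_ti2_tan b1).
  have lp := is_derive_compDl (f := fun s => ln (tan s)) (is_derive_ln_tan bp).
  have lm := is_derive_compBl (f := fun s => ln (tan s)) (is_derive_ln_tan bm).
  have dp := is_derive_compDl (is_derive_logtan_int bp).
  have dm := is_derive_compBl (is_derive_logtan_int bm).
  have d := is_deriveD (is_deriveB (is_deriveB (is_deriveB (is_deriveZ 3^-1 d3) d1)
    (is_deriveM (is_derive_id t 1) (is_deriveD lm lp))) dp) dm.
  apply: (@ex_derive _ _ _ _ _ _ _ (eq_is_derive (g := W) d _ erefl)) => s.
  by rewrite /W [in RHS](mulrC _ 3^-1).
have : W (pi / 12) = W 0 by apply: derive0_eq => //; lra.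
have W0 : W 0 = 0 by rewrite /W mulr0 tan0 ti2_0 addr0 !subr0; field.
rewrite W0 -VW; last lra.
rewrite /V.
have -> : 3 * (pi / 12) = pi / 4 :> R by field.
have -> : pi / 3 + pi / 12 = pi * 5 / 12 :> R by field.
have -> : pi / 3 - pi / 12 = pi / 4 :> R by field.
have -> : logtan_int (pi / 12) = logtan_int (pi * 5 / 12) :> R.
  by rewrite -logtan_int_sym; [congr logtan_int; field|lra].
have <- : logtan_int (pi / 4) = catalan R.
  by rewrite /logtan_int tan_piquarter ln1 mulr0 subr0 ti2_1.
lra.
Qed.

(** * Integration of ln tan in the sine coordinate *)

(** This is the derivative of the integral of ln tan (pi/4 + a) with respect to
    u = sin a; it is also (2 / s) artanh (u / s) for s = sqrt (1 - u^2), whence the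
    name. *)
Definition artanh_kernel {R : realType} (u : R) : R :=
  (Num.sqrt (1 - u ^+ 2))^-1 *
  ln ((Num.sqrt (1 - u ^+ 2) + u) / (Num.sqrt (1 - u ^+ 2) - u)).

Lemma asin_half (R : realType) : asin (1 / 2) = pi / 6 :> R.
Proof.
have pi0 := pi_gt0 R.
rewrite -cos_pithird (_ : pi / 3 = - (pi / 6) + pi / 2); last by field.
by rewrite cosDpihalf sinN opprK sinK// in_itv/=; lra.
Qed.

Lemma asin_bounds {R : realType} {u : R} : 0 <= u <= 1 / 2 -> 0 <= asin u <= pi / 6.
Proof.
move=> /andP[u0 u1]; have pi0 := pi_gt0 R.
have ub : -1 <= u <= 1 by lra.
have au : asin u \in `[(- (pi / 2)), pi / 2].
  by rewrite in_itv/= asin_geNpi2// asin_lepi2.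
have a0 : (0 : R) \in `[(- (pi / 2)), pi / 2] by rewrite in_itv/=; lra.
have a6 : (pi / 6 : R) \in `[(- (pi / 2)), pi / 2] by rewrite in_itv/=; lra.
have su : sin (asin u) = u by rewrite asinK// in_itv.
have s6 : sin (pi / 6) = 1 / 2 :> R.
  by rewrite -asin_half asinK// in_itv/=; lra.
apply/andP; split.
  by rewrite leNgt -(ltr_sin au a0) su sin0 -leNgt.
by rewrite leNgt -(ltr_sin a6 au) su s6 -leNgt.
Qed.

Lemma sqrt_gt_half {R : realType} {u : R} :
  0 <= u <= 1 / 2 -> 1 / 2 < Num.sqrt (1 - u ^+ 2).
Proof.
move=> ub.
rewrite -[1 / 2]ger0_norm ?divr_ge0// -sqrtr_sqr ltr_sqrt; nra.
Qed.

Lemma is_derive_artanh_primitive (R : realType) (u : R) : 0 <= u <= 1 / 2 ->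
  is_derive u 1 (fun v : R => - logtan_int (pi / 4 + asin v)) (artanh_kernel u).
Proof.
move=> ub; have := asin_bounds ub => ab; have pi0 := pi_gt0 R.
have u1 : -1 < u < 1 by lra.
have u1' : -1 <= u <= 1 by lra.
(* The argument of K stays in ]0, pi/2[ because asin u <= pi/6. *)
have b : 0 < pi / 4 + asin u < pi / 2 by lra.
have d := is_derive_compDl (is_derive_logtan_int b).
have dd := is_deriveN (is_derive1_comp d (is_derive1_asin u1)).
apply: (eq_is_derive dd) => [//|].
rewrite /artanh_kernel mulNr opprK mulrC; congr (_ * ln _).
have sh := sqrt_gt_half ub.
have c4 : cos (pi / 4 : R) != 0 by rewrite gt_eqF// cos_gt0_pihalf//; lra.
have ca : cos (asin u) != 0 by rewrite cos_asin// gt_eqF//; lra.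
rewrite tanD// tan_piquarter mul1r /tan cos_asin// asinK ?in_itv//.
move: (Num.sqrt _) sh => s sh; field; lra.
Qed.

Lemma continuous_artanh_kernel (R : realType) (u : R) : 0 <= u <= 1 / 2 ->
  {for u, continuous (@artanh_kernel R)}.
Proof.
move=> ub; have sh := sqrt_gt_half ub.
have cs : {for u, continuous (fun v : R => Num.sqrt (1 - v ^+ 2))}.
  apply: (@continuous_comp _ _ _ (fun v : R => 1 - v ^+ 2) (@Num.sqrt R)).
    by apply: continuousB; [exact: cst_continuous|exact: exprn_continuous].
  exact: sqrt_continuous.
have s0 : Num.sqrt (1 - u ^+ 2) != 0 by rewrite gt_eqF//; lra.
have d0 : Num.sqrt (1 - u ^+ 2) - u != 0 by rewrite gt_eqF//; lra.
apply: continuousM; first exact: continuousV.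
apply: continuous_comp; last first.
  by apply: continuous_ln; apply: divr_gt0; lra.
apply: continuousM; first by apply: continuousD.
by apply: continuousV => //; apply: continuousB.
Qed.

Lemma integral_artanh_kernel (R : realType) :
  (\int[lebesgue_measure]_(u in `[0%R, (1 / 2)%R]) (@artanh_kernel R u)%:E =
   (catalan R / 3)%:E)%E.
Proof.
have half_gt0 : 0 < 1 / 2 :> R by lra.
rewrite (integral_antiderivative half_gt0 (is_derive_artanh_primitive R)
  (continuous_artanh_kernel R)).
rewrite asin_half -logtan_int_gap; congr EFin.
have -> : asin 0 = 0 :> R.
  by rewrite -[X in asin X]sin0 sinK// in_itv/=; have := pi_gt0 R; lra.
have -> : pi / 4 + pi / 6 = pi * 5 / 12 :> R by field.
by rewrite addr0; field.
Qed.

(** * Lebesgue integrals under scaling and parity *)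

Local Open Scope ereal_scope.

(** By uniqueness of the Lebesgue measure, it is enough to compare the two sides on
    half-open intervals. *)
Lemma lebesgue_measure_scale (R : realType) (a : R) (A : set R) : (0 < a)%R ->
  measurable A ->
  a%:E * lebesgue_measure ((fun x : R => (a * x)%R) @^-1` A) = lebesgue_measure A.
Proof.
move=> a0 mA.
have mphi : measurable_fun setT
    ((fun x => a * x)%R : measurableTypeR R -> measurableTypeR R).
  exact: mulrl_measurable.
pose phi : {mfun measurableTypeR R >-> measurableTypeR R} :=
  HB.pack (fun x : R => (a * x)%R) (isMeasurableFun.Build _ _ _ _ _ mphi).
pose a' := NngNum (ltW a0).
apply/esym.
apply: (@lebesgue_measure_unique R
  (mscale a' (pushforward lebesgue_measure phi))) => //.
move=> _ [[x y]] _ <-.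
have E : (fun z : R => (a * z)%R) @^-1` `]x, y] = `](x / a)%R, (y / a)%R]%classic.
  by apply/seteqP; split=> z /=;
    rewrite !in_itv/= ltr_pdivrMr// ler_pdivlMr// ![(z * a)%R]mulrC.
rewrite /= -[RHS]/(a%:E *
  lebesgue_measure ((fun z : R => (a * z)%R) @^-1` `]x, y]%classic)) E.
rewrite !lebesgue_measure_itv/= !lte_fin ltr_pM2r ?invr_gt0//.
case: ifP => _; last by rewrite mule0.
by rewrite -!EFinB -EFinM; congr EFin; field; rewrite gt_eqF.
Qed.

Lemma ge0_integral_scale (R : realType) (a : R) (f : R -> \bar R) : (0 < a)%R ->
  measurable_fun setT f -> (forall x, 0 <= f x) ->
  \int[lebesgue_measure]_x f x = \int[lebesgue_measure]_x (a%:E * f (a * x)%R).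
Proof.
move=> a0 mf f0.
have mphi : measurable_fun setT
    ((fun x => a * x)%R : measurableTypeR R -> measurableTypeR R).
  exact: mulrl_measurable.
pose phi : {mfun measurableTypeR R >-> measurableTypeR R} :=
  HB.pack (fun x : R => (a * x)%R) (isMeasurableFun.Build _ _ _ _ _ mphi).
pose a' := NngNum (ltW a0).
rewrite (eq_measure_integral
  (mscale a' (pushforward lebesgue_measure phi))); last first.
  by move=> A mA _; rewrite -[LHS](lebesgue_measure_scale R a).
rewrite ge0_integral_mscale//= ge0_integral_pushforward//= ge0_integralZl_EFin//.
- exact: (measurableT_comp mf mphi).
- exact: ltW.
Qed.

Lemma ge0_integral_scale2 (R : realType) (a : R) (g : R * R -> \bar R) :
  (0 < a)%R ->
  measurable_fun setT g -> (forall p, 0 <= g p) ->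
  \int[lebesgue_measure]_x \int[lebesgue_measure]_y g (x, y) =
  \int[lebesgue_measure]_x \int[lebesgue_measure]_y
    ((a ^+ 2)%:E * g ((a * x)%R, (a * y)%R)).
Proof.
move=> a0 mg g0.
have mF := measurable_fun_fubini_tonelli_F (m2 := @lebesgue_measure R) g mg g0.
rewrite (ge0_integral_scale _ a _ a0 mF); last first.
  by move=> x; apply: integral_ge0 => y _; exact: g0.
apply: eq_integral => x _; rewrite /fubini_F.
have mgx : measurable_fun setT (fun y : R => g ((a * x)%R, y)).
  exact: measurableT_comp.
rewrite -ge0_integralZl_EFin//; last exact: ltW.
rewrite [LHS](ge0_integral_scale _ a)//.
- by apply: eq_integral => y _; rewrite muleA -EFinM.
- by apply: measurable_funeM.
- by move=> y; apply: mule_ge0 => //; rewrite lee_fin ltW.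
Qed.

Lemma ge0_integral_even (R : realType) (f : R -> \bar R) :
  measurable_fun setT f -> (forall x, 0 <= f x) -> (forall x, f (- x)%R = f x) ->
  \int[lebesgue_measure]_x f x =
  2%:E * \int[lebesgue_measure]_(x in `[0%R, +oo[) f x.
Proof.
move=> mf f0 fN.
have -> : [set: R] = `]-oo, 0%R[ `|` `[0%R, +oo[ by rewrite -setCitvr setvU.
rewrite ge0_integral_setU//=; last 2 first.
- exact: measurable_funTS.
- apply/disj_setPS => x [] /=; rewrite !in_itv/= andbT => x0 x1.
  by move: x0; rewrite ltNge x1.
rewrite integral_itv_bndo_bndc; last exact: measurable_funTS.
rewrite mule_natl mule2n; congr (_ + _).
rewrite ge0_integration_by_substitution0//.
by apply: eq_integral => x _; rewrite fN.
Qed.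

(** * Integration along the height *)

(** The integrand of the theorem after the substitution y = t (u, v), at the point
    (t, (u, v)): the factor t^3 is t times the Jacobian t^2. *)
Definition scaled_integrand {R : realType} (p : R * (R * R)) : \bar R :=
  if [&& 0 < p.1, p.1 ^+ 4 * (1 - (p.2.1 ^+ 2 + p.2.2 ^+ 2)) <= 1,
            `|p.2.1| <= 1 / 2 & `|p.2.2| <= 1 / 2]%R then (p.1 ^+ 3)%:E else 0.

Lemma scaled_integrand_ge0 (R : realType) (p : R * (R * R)) :
  0 <= scaled_integrand p.
Proof.
rewrite /scaled_integrand; case: ifPn => // /and4P[t0 _ _ _].
by rewrite lee_fin exprn_ge0// ltW.
Qed.

Lemma measurable_scaled_integrand (R : realType) :
  measurable_fun setT (@scaled_integrand R).
Proof.
have mt : measurable_fun setT (fun p : R * (R * R) => p.1) by exact: measurable_fst.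
have mu : measurable_fun setT (fun p : R * (R * R) => p.2.1).
  by apply: measurableT_comp => //; exact: measurable_snd.
have mv : measurable_fun setT (fun p : R * (R * R) => p.2.2).
  by apply: measurableT_comp => //; exact: measurable_snd.
apply: measurable_fun_ifT => //; last exact/measurable_EFinP/measurable_funX.
apply: measurable_and; first exact: measurable_fun_ltr.
apply: measurable_and.
  apply: measurable_fun_ler => //.
  apply: measurable_funM; first exact: measurable_funX.
  by apply: measurable_funB => //; apply: measurable_funD; exact: measurable_funX.
by apply: measurable_and; apply: measurable_fun_ler => //; exact: measurableT_comp.
Qed.

(** The integral of [scaled_integrand] over t ([integral_scaled_integrand]). *)
Definition fiber_mass {R : realType} (w : R * R) : \bar R :=
  if ((`|w.1| <= 1 / 2) && (`|w.2| <= 1 / 2))%R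
  then ((4 * (1 - (w.1 ^+ 2 + w.2 ^+ 2)))^-1)%:E else 0.

(** For w = 1 - u^2 - v^2, which is positive on the square, t ranges over ]0, q]
    where q^4 = 1 / w, and the integral of t^3 is q^4 / 4. *)
Lemma integral_scaled_integrand (R : realType) (p : R * R) :
  \int[lebesgue_measure]_t scaled_integrand (t, p) = fiber_mass p.
Proof.
case: p => u v; rewrite /scaled_integrand /fiber_mass/=.
case: ifPn => [uv|/negbTE uv]; last first.
  by apply: integral0_eq => t _; rewrite !andbF.
set w := (1 - (u ^+ 2 + v ^+ 2))%R.
have w0 : (0 < w)%R.
  have [u2 v2] : (u ^+ 2 <= 1 / 4 /\ v ^+ 2 <= 1 / 4)%R.
    by move: uv; rewrite !ler_norml => /andP[/andP[? ?] /andP[? ?]]; split; nra.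
  by rewrite /w; lra.
set q := (Num.sqrt (Num.sqrt w^-1)).
have q0 : (0 < q)%R by rewrite !sqrtr_gt0 invr_gt0.
have q4 : (q ^+ 4 = w^-1)%R.
  by rewrite (exprM q 2 2) !sqr_sqrtr ?sqrtr_ge0// invr_ge0 ltW.
transitivity (\int[lebesgue_measure]_(t in `]0%R, q]) (t ^+ 3)%:E).
  rewrite [RHS]integral_mkcond; apply: eq_integral => t _.
  rewrite andbT /patch; congr (if _ then _ else _).
  apply/idP/idP; rewrite inE /= in_itv/=.
    move=> /andP[t0]; rewrite -ler_pdivlMr// div1r -q4 t0/=.
    by rewrite ler_pXn2r// nnegrE ltW.
  move=> /andP[t0 tq]; rewrite t0/= -ler_pdivlMr// div1r -q4.
  by rewrite ler_pXn2r// nnegrE ltW.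
rewrite integral_itv_obnd_cbnd; last first.
  by apply/measurable_EFinP; exact: exprn_measurable.
have dp (t : R) : is_derive t 1%R (fun s => 4^-1 * s ^+ 4)%R (t ^+ 3)%R.
  by apply: (eq_is_derive (is_derive_monomial _ 4^-1 t 3)) => //; field.
rewrite (integral_antiderivative q0 (fun t _ => dp t)
  (fun t _ => @exprn_continuous R 3 t)).
by rewrite q4 expr0n/= mulr0 subr0 invfM.
Qed.

(** A marginal of a measurable nonnegative function is measurable. *)
Lemma measurable_fiber_mass (R : realType) : measurable_fun setT (@fiber_mass R).
Proof.
rewrite (_ : fiber_mass = fubini_G lebesgue_measure (@scaled_integrand R)).
  by apply: measurable_fun_fubini_tonelli_G;
    [exact: measurable_scaled_integrand|exact: scaled_integrand_ge0].
by apply/funext => w; rewrite -integral_scaled_integrand.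
Qed.

Lemma fiber_mass_ge0 (R : realType) (w : R * R) : 0 <= fiber_mass w.
Proof.
rewrite -integral_scaled_integrand; apply: integral_ge0 => t _.
exact: scaled_integrand_ge0.
Qed.

(** * Integration over the square *)

(** Partial fractions: 1 - u^2 - v^2 = (s + v) (s - v) for s = sqrt (1 - u^2). *)
Lemma integral_symmetric_slice (R : realType) (u : R) : (0 <= u <= 1 / 2)%R ->
  \int[lebesgue_measure]_(v in `[(- u)%R, u])
    ((4 * (1 - (u ^+ 2 + v ^+ 2)))^-1)%:E = (artanh_kernel u / 4)%:E.
Proof.
move=> ub; have := ub => /andP[u0 uh].
have sh := sqrt_gt_half ub.
have s2 : (Num.sqrt (1 - u ^+ 2) ^+ 2 = 1 - u ^+ 2)%R by rewrite sqr_sqrtr//; nra.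
rewrite /artanh_kernel; move: (Num.sqrt _) sh s2 => s sh s2.
have [->|un0] := eqVneq u 0%R.
  rewrite oppr0 set_itv1 integral_set1 addr0 divff ?ln1 ?mulr0 ?mul0r//.
  by rewrite gt_eqF//; lra.
pose P (v : R) : R := ((4 * s)^-1 * (1 / 2) * (ln (s + v) - ln (s - v)))%R.
have dP (v : R) : (- u <= v <= u)%R ->
    is_derive v 1%R P ((4 * (1 - (u ^+ 2 + v ^+ 2)))^-1)%R.
  move=> vb.
  have p1 : (0 < s + v)%R by lra.
  have p2 : (0 < s - v)%R by lra.
  have d := is_deriveZ ((4 * s)^-1 * (1 / 2))%R (is_deriveB
    (is_derive_compDl (is_derive1_ln p1)) (is_derive_compBl (is_derive1_ln p2))).
  apply: (eq_is_derive d) => [//|].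
  have -> : (1 - (u ^+ 2 + v ^+ 2) = (s + v) * (s - v))%R.
    by rewrite opprD addrA -s2; ring.
  rewrite /GRing.scale/=; field; lra.
have cw (v : R) : (- u <= v <= u)%R ->
    {for v, continuous (fun v : R => (4 * (1 - (u ^+ 2 + v ^+ 2)))^-1)%R}.
  move=> vb; apply: continuousV; first by rewrite gt_eqF//; nra.
  apply: continuousM; first exact: cst_continuous.
  apply: continuousB; first exact: cst_continuous.
  apply: continuousD; first exact: cst_continuous.
  exact: exprn_continuous.
have ltNu : (- u < u)%R by lra.
rewrite (integral_antiderivative ltNu dP cw) /P; congr EFin.
rewrite ln_div ?posrE; [|lra|lra].
by rewrite !opprK; field; lra.
Qed.

(** The integral of [fiber_mass] over v in [-|u|, |u|]. *)
Definition slice_mass {R : realType} (u : R) : \bar R :=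
  if (`|u| <= 1 / 2)%R then (artanh_kernel `|u| / 4)%:E else 0.

Lemma integral_fiber_mass_slice (R : realType) (u : R) :
  \int[lebesgue_measure]_(v in `[(- `|u|)%R, `|u|%R]) fiber_mass (u, v) =
  slice_mass u.
Proof.
rewrite /slice_mass; case: ifPn => ub; last first.
  by apply: integral0_eq => v _; rewrite /fiber_mass/= (negbTE ub).
rewrite -integral_symmetric_slice ?normr_ge0//.
apply: eq_integral => v; rewrite inE/= in_itv/= -ler_norml => vu.
by rewrite /fiber_mass/= ub (le_trans vu ub)/= real_normK// num_real.
Qed.

Lemma integral_slice_mass (R : realType) :
  measurable_fun setT (@slice_mass R) -> (forall u : R, 0 <= slice_mass u) ->
  \int[lebesgue_measure]_u @slice_mass R u = (catalan R / 6)%:E.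
Proof.
move=> ms s0.
rewrite ge0_integral_even//; last by move=> u; rewrite /slice_mass normrN.
have -> : \int[lebesgue_measure]_(x in `[0%R, +oo[) @slice_mass R x =
    \int[lebesgue_measure]_(x in `[0%R, (1 / 2)%R])
      (4^-1%:E * (@artanh_kernel R x)%:E).
  rewrite integral_mkcond [RHS]integral_mkcond; apply: eq_integral => u _.
  rewrite /patch !mem_setE !in_itv/= andbT /slice_mass.
  case: (leP 0%R u) => u0 //=; rewrite ger0_norm//.
  by case: ifP => // _; rewrite -EFinM mulrC.
rewrite integralZl//; last first.
  apply: continuous_compact_integrable; first exact: segment_compact.
  apply: continuous_in_subspaceT => u /[!inE]; rewrite /= in_itv/=.
  exact: continuous_artanh_kernel.
by rewrite integral_artanh_kernel -!EFinM; congr EFin; field.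
Qed.

(** The square is cut along its diagonals, and the part |v| <= |u| is integrated
    first in v, the part |u| < |v| first in u. As the integrand is symmetric, both
    marginals are [slice_mass]. *)
Lemma integral_fiber_mass (R : realType) :
  \int[lebesgue_measure \x lebesgue_measure]_w @fiber_mass R w = (catalan R / 3)%:E.
Proof.
have mk := measurable_fiber_mass R.
have k0 := fiber_mass_ge0 R.
pose k1 (w : R * R) : \bar R := if (`|w.2| <= `|w.1|)%R then fiber_mass w else 0.
pose k2 (w : R * R) : \bar R := if (`|w.2| <= `|w.1|)%R then 0 else fiber_mass w.
have mb : measurable_fun setT (fun w : R * R => `|w.2| <= `|w.1|)%R.
  by apply: measurable_fun_ler; apply: measurableT_comp.
have mk1 : measurable_fun setT k1 by exact: measurable_fun_ifT.
have mk2 : measurable_fun setT k2 by exact: measurable_fun_ifT.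
have k10 w : 0 <= k1 w by rewrite /k1; case: ifP.
have k20 w : 0 <= k2 w by rewrite /k2; case: ifP.
have F1 : fubini_F lebesgue_measure k1 = @slice_mass R.
  apply/funext => u; rewrite -integral_fiber_mass_slice [RHS]integral_mkcond.
  by apply: eq_integral => v _; rewrite /k1 /patch mem_setE in_itv/= -ler_norml.
have G2 : fubini_G lebesgue_measure k2 = @slice_mass R.
  apply/funext => v; rewrite -integral_fiber_mass_slice.
  have mkv : measurable_fun setT (fun u : R => fiber_mass (v, u)).
    exact: measurableT_comp.
  (* The second part is an open interval, equal to the closed one up to a null
     set. *)
  rewrite (@integral_itv_bndoo _ _ _ _ true false); last exact: measurable_funTS.
  rewrite [RHS]integral_mkcond.
  apply: eq_integral => u _; rewrite /k2 /patch mem_setE in_itv/= -ltr_norml.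
  rewrite ltNge; case: (_ <= _)%R => //=.
  by rewrite /fiber_mass/= andbC [(_ ^+ 2 + u ^+ 2)%R]addrC.
have ms : measurable_fun setT (@slice_mass R).
  by rewrite -F1; exact: measurable_fun_fubini_tonelli_F.
have s0 (u : R) : 0 <= slice_mass u.
  by rewrite -F1; apply: integral_ge0 => v _; exact: k10.
transitivity (\int[lebesgue_measure \x lebesgue_measure]_w (k1 w + k2 w)).
  apply: eq_integral => w _; rewrite /k1 /k2.
  by case: ifP => _; rewrite ?adde0 ?add0e.
rewrite ge0_integralD//.
have -> : \int[lebesgue_measure \x lebesgue_measure]_w k1 w = (catalan R / 6)%:E.
  rewrite fubini_tonelli1// -integral_slice_mass//.
  by apply: eq_integral => u _; rewrite -F1.
have -> : \int[lebesgue_measure \x lebesgue_measure]_w k2 w = (catalan R / 6)%:E.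
  rewrite fubini_tonelli2// -integral_slice_mass//.
  by apply: eq_integral => u _; rewrite -G2.
by rewrite -EFinD; congr EFin; field.
Qed.

(** * The reduced domain *)

(** The integrand of the theorem, extended by 0 outside of the domain. For t > 0 the
    second constraint is equivalent to the one of the domain, multiplied by t^2; in
    this polynomial form it is clearly measurable. *)
Definition domain_integrand {R : realType} (p : R * R * R) : \bar R :=
  if [&& 0 < p.1.1,
         p.1.1 ^+ 4 <= (p.1.2 ^+ 2 + p.2 ^+ 2) * p.1.1 ^+ 2 + 1,
         2 * `|p.1.2| <= p.1.1 & 2 * `|p.2| <= p.1.1]%R
  then (p.1.1)%:E else 0.

Lemma domain_integrand_ge0 (R : realType) (p : R * R * R) :
  0 <= domain_integrand p.
Proof.
rewrite /domain_integrand; case: ifPn => // /and4P[t0 _ _ _].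
by rewrite lee_fin ltW.
Qed.

Lemma measurable_domain_integrand (R : realType) :
  measurable_fun setT (@domain_integrand R).
Proof.
have mt : measurable_fun setT (fun p : R * R * R => p.1.1).
  by apply: measurableT_comp => //; exact: measurable_fst.
have m1 : measurable_fun setT (fun p : R * R * R => p.1.2).
  by apply: measurableT_comp => //; exact: measurable_fst.
have m2 : measurable_fun setT (fun p : R * R * R => p.2) by exact: measurable_snd.
apply: measurable_fun_ifT => //; last exact/measurable_EFinP.
apply: measurable_and; first exact: measurable_fun_ltr.
apply: measurable_and.
  apply: measurable_fun_ler; first exact: measurable_funX.
  apply: measurable_funD => //; apply: measurable_funM; last exact: measurable_funX.
  by apply: measurable_funD; exact: measurable_funX.
by apply: measurable_and; apply: measurable_fun_ler => //;
  apply: measurable_funM => //; exact: measurableT_comp.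
Qed.

Lemma patch_reduced_domain (R : realType) (p : R * R * R) :
  ((fun p => (p.1.1)%:E) \_ (@reduced_domain R)) p = domain_integrand p.
Proof.
case: p => [[t y1] y2]; rewrite /patch /domain_integrand/=.
have E : (0 < t -> (t ^+ 2 <= y1 ^+ 2 + y2 ^+ 2 + 1 / t ^+ 2) =
    (t ^+ 4 <= (y1 ^+ 2 + y2 ^+ 2) * t ^+ 2 + 1))%R.
  move=> t0; have t2 : (0 < t ^+ 2)%R by rewrite exprn_gt0.
  by rewrite -(ler_pM2r t2) -exprD mulrDl divfK// gt_eqF.
congr (if _ then _ else _); apply/idP/idP; rewrite inE.
  by move=> -[t0 h h1 h2]; rewrite t0 -E// h h1 h2.
by move=> /and4P[t0 h h1 h2]; split => //; rewrite E.
Qed.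

(** Both sides vanish for t <= 0; otherwise substitute y = t (u, v). *)
Lemma integral_domain_slice (R : realType) (t : R) :
  \int[lebesgue_measure]_y1 \int[lebesgue_measure]_y2 domain_integrand (t, y1, y2) =
  \int[lebesgue_measure]_u \int[lebesgue_measure]_v scaled_integrand (t, (u, v)).
Proof.
have [t0|t0] := leP t 0%R.
  have z1 y1 y2 : domain_integrand (t, y1, y2) = 0.
    by rewrite /domain_integrand /= ltNge t0.
  have z2 u v : scaled_integrand (t, (u, v)) = 0.
    by rewrite /scaled_integrand /= ltNge t0.
  rewrite integral0_eq; last by move=> y1 _; exact: integral0_eq.
  by rewrite integral0_eq// => u _; exact: integral0_eq.
pose g (q : R * R) := domain_integrand (t, q.1, q.2).
have mg : measurable_fun setT g.
  apply: measurableT_comp; first exact: measurable_domain_integrand.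
  apply: measurable_fun_pair => //=; apply: measurable_fun_pair => //=.
have g0 q : 0 <= g q by exact: domain_integrand_ge0.
rewrite (ge0_integral_scale2 R t g t0 mg g0).
apply: eq_integral => u _; apply: eq_integral => v _.
rewrite /g /domain_integrand /scaled_integrand /= t0/=.
have nh (x : R) : (2 * `|t * x| <= t)%R = (`|x| <= 1 / 2)%R.
  rewrite normrM gtr0_norm// mulrCA -[leRHS]mulr1 ler_pM2l//.
  by rewrite ler_pdivlMr// mulrC.
rewrite !nh.
have -> : (t ^+ 4 <= ((t * u) ^+ 2 + (t * v) ^+ 2) * t ^+ 2 + 1)%R =
    (t ^+ 4 * (1 - (u ^+ 2 + v ^+ 2)) <= 1)%R.
  by rewrite -lerBlDl; congr (_ <= _)%R; ring.
by case: ifP => _; rewrite ?mule0// -EFinM; congr EFin; ring.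
Qed.

(** Naming the product gives its sigma-finiteness, which Tonelli's theorem asks of
    each factor, a place of its own: on a bare product, inference only tries the
    structure of a product of subprobabilities. *)
Definition plane_measure (R : realType) :
    set (measurableTypeR R * measurableTypeR R) -> \bar R :=
  lebesgue_measure \x lebesgue_measure.

HB.instance Definition _ (R : realType) := Measure.on (@plane_measure R).

Lemma plane_measure_sigma_finite (R : realType) :
  sigma_finite setT (@plane_measure R).
Proof.
pose I (n : nat) : set R := `[(- n%:R)%R, n%:R%R]%classic.
exists (fun n => I n `*` I n).
  apply/seteqP; split => // -[x y] _.
  exists (Num.bound `|x| + Num.bound `|y|)%N => //.
  have bd (z : R) (k : nat) : I (Num.bound `|z| + k)%N z.
    rewrite /I/= in_itv/= -ler_norml natrD.
    by rewrite (le_trans (ltW (archi_boundP (normr_ge0 z))))// lerDl.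
  by split => /=; [exact: bd|rewrite addnC; exact: bd].
move=> n; split; first by apply: measurableX; exact: measurable_itv.
rewrite /plane_measure product_measure1E; [|exact: measurable_itv..].
rewrite -[ltLHS]/(lebesgue_measure (I n) * lebesgue_measure (I n)).
rewrite /I !lebesgue_measure_itv/=.
by case: ifP => _; rewrite ?mule0// -EFinB -EFinM ltry.
Qed.

HB.instance Definition _ (R : realType) :=
  Measure_isSigmaFinite.Build _ _ _ (@plane_measure R)
    (@plane_measure_sigma_finite R).

(** Tonelli's theorem brings the integral over t to the inside, after the
    substitution has been made at each fixed t. *)
Lemma integral_reduced_domain (R : realType) :
  \int[lebesgue_measure \x lebesgue_measure \x lebesgue_measure]_(p in
    @reduced_domain R) (p.1.1)%:E = (catalan R / 3)%:E.
Proof.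
have mf := measurable_domain_integrand R.
have f0 := domain_integrand_ge0 R.
have mh := measurable_scaled_integrand R.
have h0 := scaled_integrand_ge0 R.
rewrite integral_mkcond; under eq_integral do rewrite patch_reduced_domain.
transitivity (\int[@plane_measure R]_q \int[lebesgue_measure]_y2
    @domain_integrand R (q.1, q.2, y2)).
  have h := fubini_tonelli1 (m1 := @plane_measure R)
    (m2 := @lebesgue_measure R) domain_integrand mf f0.
  rewrite [LHS]h.
  by apply: eq_integral => -[t y1] _.
have mF := measurable_fun_fubini_tonelli_F (m2 := @lebesgue_measure R)
  domain_integrand mf f0.
have F0 q : 0 <= fubini_F lebesgue_measure (@domain_integrand R) q.
  by apply: integral_ge0 => y _; exact: f0.
transitivity (\int[lebesgue_measure]_t \int[lebesgue_measure]_y1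
    \int[lebesgue_measure]_y2 @domain_integrand R (t, y1, y2)).
  have h := fubini_tonelli1 (m1 := @lebesgue_measure R)
    (m2 := @lebesgue_measure R) _ mF F0.
  rewrite -[RHS]h.
  by apply: eq_integral => -[t y1] _.
rewrite -integral_fiber_mass.
transitivity (\int[lebesgue_measure]_t \int[@plane_measure R]_w
  @scaled_integrand R (t, w)).
  apply: eq_integral => t _.
  rewrite integral_domain_slice.
  have mht : measurable_fun setT (fun w : R * R => scaled_integrand (t, w)).
    exact: measurableT_comp.
  have h := fubini_tonelli1 (m1 := @lebesgue_measure R)
    (m2 := @lebesgue_measure R) _ mht (fun w => h0 (t, w)).
  by rewrite [RHS]h.
rewrite (fubini_tonelli (m1 := @lebesgue_measure R) (m2 := @plane_measure R)
  (@scaled_integrand R) mh h0).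
by apply: eq_integral => w _; rewrite integral_scaled_integrand.
Qed.

Local Close Scope ereal_scope.

Theorem proposition12 (R : realType) :
  ((2 * pi ^+ 2)%:E *
     \int[lebesgue_measure \x lebesgue_measure \x lebesgue_measure]_(p in
       @reduced_domain R) (p.1.1)%:E =
   (2 * pi ^+ 2 / 3 * catalan R)%:E)%E.
Proof. by rewrite integral_reduced_domain -EFinM; congr EFin; field. Qed.
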